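(* Let $\mathcal{A}$ be a Hopf algebra and let $(\mathcal{E},d)$ be a bicovariant (first order) differential calculus over $\mathcal{A}$ such that the map ${}_0\sigma:{}_0\mathcal{E}\otimes_{\mathbb{C}}{}_0\mathcal{E}\to{}_0\mathcal{E}\otimes_{\mathbb{C}}{}_0\mathcal{E}$ is diagonalisable. Let $\wedge:\mathcal{E}\otimes_{\mathcal{A}}\mathcal{E}\to\Omega^2(\mathcal{A})$ be the wedge map. Then there exists an $\mathcal{A}$-$\mathcal{A}$-bimodule $\mathcal{F}$ (a sub-bimodule of $\mathcal{E}\otimes_{\mathcal{A}}\mathcal{E}$) such that $$\mathcal{E}\otimes_{\mathcal{A}}\mathcal{E}=\mathrm{Ker}(\wedge)\oplus\mathcal{F}.$$ Moreover, the map $\wedge|_{\mathcal{F}}:\mathcal{F}\to\Omega^2(\mathcal{A})$ is an isomorphism of right $\mathcal{A}$-modules.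
   Context: All vector spaces are over $\mathbb{C}$. $\mathcal{A}$ is a Hopf algebra with coproduct $\Delta$; Sweedler notation $\Delta(a)=a_{(1)}\otimes a_{(2)}$, left coactions $m\mapsto m_{(-1)}\otimes m_{(0)}$, right coactions $m\mapsto m_{(0)}\otimes m_{(1)}$. A left-covariant $\mathcal{A}$-bimodule is an $\mathcal{A}$-bimodule $M$ with a left comodule coaction $\Delta_M:M\to\mathcal{A}\otimes_{\mathbb{C}}M$ such that $\Delta_M(am)=\Delta(a)\Delta_M(m)$ and $\Delta_M(ma)=\Delta_M(m)\Delta(a)$. A right-covariant bimodule is defined in the same way with a right comodule coaction ${}_M\Delta:M\to M\otimes_{\mathbb{C}}\mathcal{A}$. A bicovariant bimodule has both structures, with $(\mathrm{id}\otimes{}_M\Delta)\Delta_M=(\Delta_M\otimes\mathrm{id}){}_M\Delta$. Put ${}_0M=\{m:\Delta_M(m)=1\otimes m\}$ and $M_0=\{m:{}_M\Delta(m)=m\otimes1\}$. $M\otimes_{\mathcal{A}}N$ carries the diagonal coactions $m\otimes n\mapsto m_{(-1)}n_{(-1)}\otimes(m_{(0)}\otimes n_{(0)})$ and $m\otimes n\mapsto(m_{(0)}\otimes n_{(0)})\otimes m_{(1)}n_{(1)}$. Recalled facts (Woronowicz, Schauenburg): the multiplication map ${}_0M\otimes_{\mathbb{C}}\mathcal{A}\to M$ is an isomorphism and ${}_0(M\otimes_{\mathcal{A}}N)={}_0M\otimes_{\mathbb{C}}{}_0N$. A first order differential calculus over $\mathcal{A}$ is an $\mathcal{A}$-bimodule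 $\mathcal{E}$ with a linear map $d:\mathcal{A}\to\mathcal{E}$ such that $d(ab)=(da)b+a\,db$ and every element of $\mathcal{E}$ is of the form $\sum_ka_kdb_k$. It is bicovariant if $\sum_ka_kdb_k=0$ implies both $\sum_k\Delta(a_k)(\mathrm{id}\otimes d)\Delta(b_k)=0$ and $\sum_k\Delta(a_k)(d\otimes\mathrm{id})\Delta(b_k)=0$; then $\mathcal{E}$ is a bicovariant bimodule with coactions determined by $\Delta_{\mathcal{E}}\circ d=(\mathrm{id}\otimes d)\Delta$ and ${}_{\mathcal{E}}\Delta\circ d=(d\otimes\mathrm{id})\Delta$. Standing assumption: ${}_0\mathcal{E}$ and $\mathcal{E}_0$ are finite-dimensional. $\sigma:\mathcal{E}\otimes_{\mathcal{A}}\mathcal{E}\to\mathcal{E}\otimes_{\mathcal{A}}\mathcal{E}$ is Woronowicz's canonical braiding: the unique bimodule homomorphism with $\sigma(\omega\otimes\eta)=\eta\otimes\omega$ for $\omega\in{}_0\mathcal{E}$, $\eta\in\mathcal{E}_0$. It is invertible, bicovariant (it commutes with both coactions) and satisfies the braid equation. ${}_0\sigma$ is its restriction to ${}_0(\mathcal{E}\otimes_{\mathcal{A}}\mathcal{E})={}_0\mathcal{E}\otimes_{\mathbb{C}}{}_0\mathcal{E}$. Finally $\Omega^2(\mathcal{A}):=(\mathcal{E}\otimes_{\mathcal{A}}\mathcal{E})/\mathrm{Ker}(\sigma-1)$ and $\wedge$ is the quotient map. *)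

(* Defs.v *)
From HB Require Import structures.
From mathcomp Require Import all_boot all_algebra.
From mathcomp Require Import boolp reals complex ring_quotient freeg.

Set Implicit Arguments.
Unset Strict Implicit.
Unset Printing Implicit Defensive.

Import GRing.Theory.
Local Open Scope ring_scope.
Local Open Scope quotient_scope.

Section Span.
Variables (K : fieldType) (V : lmodType K) (S : V -> Prop).

Definition lspan : {pred V} := fun x =>
  `[< forall W : submodClosed V, (forall y, S y -> y \in W) -> x \in W >].

Lemma lspan_submod_closed : submod_closed lspan.
Proof.
split=> [|a x y /asboolP xW /asboolP yW]; apply/asboolP => W SW.
  exact: rpred0.
by rewrite rpredD ?rpredZ ?xW ?yW.
Qed.

HB.instance Definition _ := GRing.isSubmodClosed.Build K V lspan
  (GRing.submod_closed_semi lspan_submod_closed).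

Lemma mem_lspan x : S x -> x \in lspan.
Proof. by move=> Sx; apply/asboolP => W; apply. Qed.

Lemma lspan_min (P : V -> Prop) : P 0 ->
  (forall k x y, P x -> P y -> P (k *: x + y)) -> (forall x, S x -> P x) ->
  forall x, x \in lspan -> P x.
Proof.
move=> P0 Plin PS x /asboolP Wx.
pose Q : {pred V} := fun x => `[< P x >].
have Qc : submod_closed Q.
  by split=> [|a y z /asboolP Py /asboolP Pz]; apply/asboolP; [|apply: Plin].
pose W : submodClosed V := HB.pack Q
  (GRing.isSubmodClosed.Build K V Q (GRing.submod_closed_semi Qc)).
by have /asboolP := Wx W (fun y Sy => asboolT (PS y Sy)).
Qed.

End Span.

Section QuotientModule.
Variables (K : fieldType) (V : lmodType K) (W : submodClosed V).

Lemma submod_zmod_closed : zmod_closed W.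
Proof. exact/GRing.submod_closedB/submodClosedP. Qed.

Definition submod_zmod : zmodClosed V :=
  
  HB.pack (GRing.SubmodClosed.sort W)
    (GRing.isZmodClosed.Build V (GRing.SubmodClosed.sort W) submod_zmod_closed).

Definition lquot_sort : Type := Quotient.quot submod_zmod.
HB.instance Definition _ := ZmodQuotient.on lquot_sort.

Lemma lquot_eq (x y : V) : \pi_lquot_sort x = \pi_lquot_sort y <-> x - y \in W.
Proof.
by rewrite (Quotient.idealrBE submod_zmod); split=> [->|/eqP].
Qed.

Definition lquot_scale (k : K) (x : lquot_sort) : lquot_sort :=
  \pi_lquot_sort (k *: repr x).

Lemma lquot_scale_pi k x :
  lquot_scale k (\pi_lquot_sort x) = \pi_lquot_sort (k *: x).
Proof. by apply/lquot_eq; rewrite -scalerBr rpredZ //; apply: (lquot_eq _ _).1; rewrite reprK. Qed.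

Let lquot_surj (x : lquot_sort) : exists y, x = \pi_lquot_sort y.
Proof. by exists (repr x); rewrite reprK. Qed.

Fact lquot_scaleA a b x : lquot_scale a (lquot_scale b x) = lquot_scale (a * b) x.
Proof. by have [{}x ->] := lquot_surj x; rewrite !lquot_scale_pi scalerA. Qed.
Fact lquot_scale1 x : lquot_scale 1 x = x.
Proof. by have [{}x ->] := lquot_surj x; rewrite lquot_scale_pi scale1r. Qed.
Fact lquot_scaleDr k x y :
  lquot_scale k (x + y) = lquot_scale k x + lquot_scale k y.
Proof.
by have [{}x ->] := lquot_surj x; have [{}y ->] := lquot_surj y; rewrite -raddfD !lquot_scale_pi scalerDr raddfD.
Qed.
Fact lquot_scaleDl x a b :
  lquot_scale (a + b) x = lquot_scale a x + lquot_scale b x.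
Proof. by have [{}x ->] := lquot_surj x; rewrite !lquot_scale_pi scalerDl raddfD. Qed.

HB.instance Definition _ := GRing.Zmodule_isLmodule.Build K lquot_sort
  lquot_scaleA lquot_scale1 lquot_scaleDr lquot_scaleDl.

Definition lquot : lmodType K := lquot_sort.
Definition lproj (x : V) : lquot := \pi_lquot_sort x.

Fact lproj_linear : linear lproj.
Proof. by move=> k x y; rewrite /lproj raddfD /= -lquot_scale_pi. Qed.
HB.instance Definition _ := GRing.isLinear.Build K V lquot *:%R lproj lproj_linear.

Lemma lproj_eq x y : lproj x = lproj y <-> x - y \in W.
Proof. exact: lquot_eq. Qed.

Lemma lproj_eq0 x : lproj x = 0 <-> x \in W.
Proof. by rewrite -(raddf0 lproj) lproj_eq subr0. Qed.

Lemma lproj_surj (x : lquot) : exists y, x = lproj y.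
Proof. by exists (repr (x : lquot_sort)); rewrite /lproj reprK. Qed.

Definition qlift (P : lmodType K) (f : V -> P) (x : lquot) : P :=
  f (repr (x : lquot_sort)).

Section QliftTheory.
Variables (P : lmodType K) (f : V -> P).
Hypotheses (f_lin : linear f) (fW : forall x, x \in W -> f x = 0).

Lemma qlift_proj x : qlift f (lproj x) = f x.
Proof.
pose F : {linear V -> P} := HB.pack f (GRing.isLinear.Build K V P *:%R f f_lin).
apply/eqP; rewrite -subr_eq0 -[f]/(F : _ -> _) -raddfB; apply/eqP/fW.
by apply: (lproj_eq _ _).1; rewrite /lproj reprK.
Qed.

Lemma qlift_linear : linear (qlift f).
Proof.
move=> k x y; have [x' ->] := lproj_surj x; have [y' ->] := lproj_surj y.
by rewrite -linearP !qlift_proj f_lin.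
Qed.
End QliftTheory.
End QuotientModule.

Section TensorProduct.
Variables (K : fieldType) (M N : lmodType K).

Inductive bilinear_rel : {freeg (M * N)%type / K} -> Prop :=
| BilinearL k m m' n : bilinear_rel
    (<<(k *: m + m', n)>> - (k *: <<(m, n)>> + <<(m', n)>>))
| BilinearR k m n n' : bilinear_rel
    (<<(m, k *: n + n')>> - (k *: <<(m, n)>> + <<(m, n')>>)).

Definition tprod : lmodType K := lquot (lspan bilinear_rel).
Definition tens (m : M) (n : N) : tprod := lproj _ <<(m, n)>>.

Definition bilinear_map (P : lmodType K) (f : M -> N -> P) :=
  (forall m, linear (f m)) /\ (forall n, linear (f^~ n)).

(* Total by evaluating at a representative; it is the map induced by f only
   when f is bilinear, see tlift_tens and tlift_linear. *)
Definition tlift (P : lmodType K) (f : M -> N -> P) : tprod -> P :=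
  qlift (fglift (fun p => f p.1 p.2)).

Lemma tens_bilinear : bilinear_map tens.
Proof.
split=> [m|n] k x y.
  rewrite -[RHS](linearP (lproj (lspan bilinear_rel)) k <<(m, x)>> <<(m, y)>>).
  exact/lproj_eq/mem_lspan/BilinearR.
rewrite -[RHS](linearP (lproj (lspan bilinear_rel)) k <<(x, n)>> <<(y, n)>>).
exact/lproj_eq/mem_lspan/BilinearL.
Qed.

Lemma fglift_linear (P : lmodType K) (T : choiceType) (f : T -> P) :
  linear (fglift f : {freeg T / K} -> P).
Proof.
pose F : {additive {freeg T / K} -> P} := HB.pack (fglift f)
  (GRing.isZmodMorphism.Build _ _ _ (lift_is_additive f)).
move=> k x y; rewrite -[fglift f]/(F : _ -> _) raddfD; congr (_ + _).
have -> : k *: x = \sum_(t <- dom x) << k * coeff t x *g t >> by [].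
rewrite -[x in RHS]freeg_sumE !raddf_sum; apply: eq_bigr => t _.
by rewrite /= !liftU scalerA.
Qed.

Section TliftTheory.
Variables (P : lmodType K) (f : M -> N -> P).
Hypothesis f_bil : bilinear_map f.

Let g := fglift (fun p : M * N => f p.1 p.2) : {freeg (M * N)%type / K} -> P.

Let g_rel x : x \in lspan bilinear_rel -> g x = 0.
Proof.
have gl := @fglift_linear P _ (fun p : M * N => f p.1 p.2).
pose F : {linear {freeg (M * N)%type / K} -> P} :=
  HB.pack g (GRing.isLinear.Build _ _ _ _ g gl).
rewrite -[g]/(F : _ -> _).
move: x; apply: lspan_min => [|k x y Fx Fy|_ [k m m' n|k m n n']].
- exact: raddf0.
- by rewrite linearP Fx Fy scaler0 addr0.
- rewrite linearB linearP /= /g !liftU !scale1r /=.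
  by rewrite (f_bil.2 n) subrr.
- rewrite linearB linearP /= /g !liftU !scale1r /=.
  by rewrite (f_bil.1 m) subrr.
Qed.

Lemma tlift_tens m n : tlift f (tens m n) = f m n.
Proof.
by rewrite /tlift qlift_proj ?liftU ?scale1r //; apply: fglift_linear.
Qed.

Lemma tlift_linear : linear (tlift f).
Proof. by apply: qlift_linear g_rel; apply: fglift_linear. Qed.
End TliftTheory.

Lemma tens_sum (x : tprod) : exists s : seq (M * N), x = \sum_(p <- s) tens p.1 p.2.
Proof.
have [y ->] := lproj_surj x; rewrite -[y]freeg_sumE raddf_sum.
exists [seq (coeff z y *: z.1, z.2) | z <- dom y]; rewrite [RHS]big_map.
apply: eq_bigr => -[m n] _ /=.
have tZ : coeff (m, n) y *: tens m n = tens (coeff (m, n) y *: m) n.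
  have := tens_bilinear.2 n (coeff (m, n) y) m 0.
  have -> : tens 0 n = 0.
    by have := tens_bilinear.2 n (-1) 0 0; rewrite !scaleN1r oppr0 addr0 addNr.
  by rewrite !addr0 => ->.
rewrite -tZ /tens -linearZ; congr (lproj _ _).
by apply/eqP/freeg_eqP => z; rewrite coeffZ !coeffU mul1r.
Qed.

Lemma tens_ext (P : lmodType K) (f g : tprod -> P) : linear f -> linear g ->
  (forall m n, f (tens m n) = g (tens m n)) -> f =1 g.
Proof.
move=> fl gl fg x.
pose F : {linear tprod -> P} := HB.pack f (GRing.isLinear.Build _ _ _ _ f fl).
pose G : {linear tprod -> P} := HB.pack g (GRing.isLinear.Build _ _ _ _ g gl).
rewrite -[f]/(F : _ -> _) -[g]/(G : _ -> _).
by have [s ->] := tens_sum x; rewrite !raddf_sum; apply: eq_bigr => p _; apply: fg.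
Qed.

End TensorProduct.

Notation "M \ox N" := (tprod M%type N%type)
  (at level 40, left associativity) : type_scope.
Notation "m \ox n" := (tens m n)
  (at level 40, left associativity) : ring_scope.

Section TensorMaps.
Variable K : fieldType.
Implicit Types M N P : lmodType K.

Definition tmap M M' N N' (f : M -> M') (g : N -> N') : M \ox N -> M' \ox N' :=
  tlift (fun m n => f m \ox g n).

(* (m ⊗ n, m' ⊗ n') |-> f m m' ⊗ g n n'. With multiplications and actions for f
   and g this is the product of A ⊗ A and its action on A ⊗ M or M ⊗ A, as in
   Delta_M(am) = Delta(a) Delta_M(m). *)
Definition tmap2 M M' M'' N N' N''
    (f : M -> M' -> M'') (g : N -> N' -> N'')
    (x : M \ox N) (y : M' \ox N') : M'' \ox N'' :=
  tlift (fun m n => tmap (f m) (g n) y) x.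

Definition tassoc M N P : (M \ox N) \ox P -> M \ox (N \ox P) :=
  tlift (fun x p => tlift (fun m n => m \ox (n \ox p)) x).

Lemma tmap_bilinear M M' N N' (f : M -> M') (g : N -> N') :
  linear f -> linear g -> bilinear_map (fun m n => f m \ox g n).
Proof.
move=> fl gl; split=> [m|n] k x y; first by rewrite gl (tens_bilinear _ _).1.
by rewrite fl (tens_bilinear _ _).2.
Qed.

Lemma tmap_tens M M' N N' (f : M -> M') (g : N -> N') m n :
  linear f -> linear g -> tmap f g (m \ox n) = f m \ox g n.
Proof. by move=> fl gl; rewrite /tmap tlift_tens //; apply: tmap_bilinear. Qed.

Lemma tmap_linear M M' N N' (f : M -> M') (g : N -> N') :
  linear f -> linear g -> linear (tmap f g).
Proof. by move=> fl gl; apply/tlift_linear/tmap_bilinear. Qed.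

Let tmap2_bilinear0 M M' M'' N N' N''
    (f : M -> M' -> M'') (g : N -> N' -> N'') (y : M' \ox N') :
  bilinear_map f -> bilinear_map g ->
  bilinear_map (fun m n => tmap (f m) (g n) y).
Proof.
move=> fb gb.
split=> [m|n] k u v; move: y.
  apply: (tens_ext (f := tmap (f m) (g (k *: u + v)))
    (g := fun y => k *: tmap (f m) (g u) y + tmap (f m) (g v) y)).
  - by apply: tmap_linear; [apply: fb.1|apply: gb.1].
  - move=> l z z'; rewrite !tmap_linear; try exact: fb.1; try exact: gb.1.
    by rewrite !scalerDr !scalerA mulrC addrACA.
  move=> x z; rewrite !tmap_tens; try exact: fb.1; try exact: gb.1.
  by rewrite gb.2 (tens_bilinear _ _).1.
apply: (tens_ext (f := tmap (f (k *: u + v)) (g n))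
  (g := fun y => k *: tmap (f u) (g n) y + tmap (f v) (g n) y)).
- by apply: tmap_linear; [apply: fb.1|apply: gb.1].
- move=> l z z'; rewrite !tmap_linear; try exact: fb.1; try exact: gb.1.
  by rewrite !scalerDr !scalerA mulrC addrACA.
move=> x z; rewrite !tmap_tens; try exact: fb.1; try exact: gb.1.
by rewrite fb.2 (tens_bilinear _ _).2.
Qed.

Lemma tmap2_bilinear M M' M'' N N' N''
    (f : M -> M' -> M'') (g : N -> N' -> N'') :
  bilinear_map f -> bilinear_map g -> bilinear_map (tmap2 f g).
Proof.
move=> fb gb.
have bil y := tmap2_bilinear0 y fb gb.
split=> [x k y y'|y]; last exact: tlift_linear.
apply: (tens_ext (f := fun x => tmap2 f g x (k *: y + y'))
  (g := fun x => k *: tmap2 f g x y + tmap2 f g x y')).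
- exact: tlift_linear.
- move=> l z z'; rewrite /tmap2 !(tlift_linear (bil _)).
  by rewrite !scalerDr !scalerA mulrC addrACA.
move=> m n; rewrite /tmap2 !(tlift_tens (bil _)).
by apply: tmap_linear; [apply: fb.1|apply: gb.1].
Qed.

Lemma tmap2_tens M M' M'' N N' N''
    (f : M -> M' -> M'') (g : N -> N' -> N'') m n m' n' :
  bilinear_map f -> bilinear_map g ->
  tmap2 f g (m \ox n) (m' \ox n') = f m m' \ox g n n'.
Proof.
move=> fb gb; rewrite /tmap2 tlift_tens; last exact: tmap2_bilinear0.
by rewrite tmap_tens //; [apply: fb.1|apply: gb.1].
Qed.

Let assoc_bilinear M N P (p : P) :
  bilinear_map (fun (m : M) (n : N) => m \ox (n \ox p)).
Proof.
split=> [m|n] k u v; last by rewrite (tens_bilinear _ _).2.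
by rewrite (tens_bilinear _ _).2 (tens_bilinear _ _).1.
Qed.

Lemma tassoc_bilinear M N P : bilinear_map
  (fun (x : M \ox N) (p : P) => tlift (fun m n => m \ox (n \ox p)) x).
Proof.
split=> [x k p q|p]; last exact/tlift_linear/assoc_bilinear.
apply: (tens_ext (f := tlift (fun m n => m \ox (n \ox (k *: p + q))))
  (g := fun x => k *: tlift (fun m n => m \ox (n \ox p)) x
             + tlift (fun m n => m \ox (n \ox q)) x)).
- exact/tlift_linear/assoc_bilinear.
- move=> l z z'; rewrite (tlift_linear (assoc_bilinear M N p)) (tlift_linear (assoc_bilinear M N q)).
  by rewrite !scalerDr !scalerA mulrC addrACA.
move=> m n; rewrite !(tlift_tens (assoc_bilinear M N _)).
by rewrite (tens_bilinear _ _).1 (tens_bilinear _ _).1.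
Qed.

Lemma tassoc_tens M N P (m : M) (n : N) (p : P) :
  tassoc ((m \ox n) \ox p) = m \ox (n \ox p).
Proof.
rewrite /tassoc (tlift_tens (tassoc_bilinear M N P)).
by rewrite (tlift_tens (assoc_bilinear M N p)).
Qed.

Lemma tmap2A M1 M2 M3 M12 M23 M4 N1 N2 N3 N12 N23 N4
    (f : M12 -> M3 -> M4) (f' : M1 -> M2 -> M12)
    (h : M1 -> M23 -> M4) (h' : M2 -> M3 -> M23)
    (g : N12 -> N3 -> N4) (g' : N1 -> N2 -> N12)
    (j : N1 -> N23 -> N4) (j' : N2 -> N3 -> N23) x y z :
  bilinear_map f -> bilinear_map f' -> bilinear_map h -> bilinear_map h' ->
  bilinear_map g -> bilinear_map g' -> bilinear_map j -> bilinear_map j' ->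
  (forall a b c, f (f' a b) c = h a (h' b c)) ->
  (forall a b c, g (g' a b) c = j a (j' b c)) ->
  tmap2 f g (tmap2 f' g' x y) z = tmap2 h j x (tmap2 h' j' y z).
Proof.
move=> fb f'b hb h'b gb g'b jb j'b fh gj.
have B := tmap2_bilinear fb gb; have B' := tmap2_bilinear f'b g'b.
have C := tmap2_bilinear hb jb; have C' := tmap2_bilinear h'b j'b.
move: x; apply: (tens_ext (f := fun x => tmap2 f g (tmap2 f' g' x y) z)
  (g := fun x => tmap2 h j x (tmap2 h' j' y z))) => [k u v||m1 n1].
- by rewrite B'.2 B.2.
- exact: C.2.
move: y; apply: (tens_ext (f := fun y => tmap2 f g (tmap2 f' g' (m1 \ox n1) y) z)
  (g := fun y => tmap2 h j (m1 \ox n1) (tmap2 h' j' y z))) => [k u v|k u v|m2 n2].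
- by rewrite B'.1 B.2.
- by rewrite C'.2 C.1.
move: z; apply: (tens_ext (f := fun z => tmap2 f g (tmap2 f' g' (m1 \ox n1) (m2 \ox n2)) z)
  (g := fun z => tmap2 h j (m1 \ox n1) (tmap2 h' j' (m2 \ox n2) z))) => [|k u v|m3 n3].
- exact: B.1.
- by rewrite C'.1 C.1.
by rewrite !tmap2_tens // fh gj.
Qed.

End TensorMaps.

(* The antipode is not assumed to be bijective. *)
Record hopfAlgebra (K : fieldType) := HopfAlgebra {
  hopf_alg :> algType K;
  comul : {linear hopf_alg -> (hopf_alg \ox hopf_alg)%type};
  counit : {linear hopf_alg -> K^o};
  antipode : {linear hopf_alg -> hopf_alg};
  comulA a : tassoc (tmap comul id (comul a)) = tmap id comul (comul a);
  counitL a : tlift (fun b c => counit b *: c) (comul a) = a;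
  counitR a : tlift (fun b c => counit c *: b) (comul a) = a;
  comul1 : comul 1 = 1 \ox 1;
  comulM a b : comul (a * b) = tmap2 *%R *%R (comul a) (comul b);
  counit1 : counit 1 = 1;
  counitM a b : counit (a * b) = counit a * counit b;
  antipodeL a : tlift (fun b c => antipode b * c) (comul a) = (counit a)%:A;
  antipodeR a : tlift (fun b c => b * antipode c) (comul a) = (counit a)%:A
}.
Arguments comul {K h}.
Arguments counit {K h}.
Arguments antipode {K h}.

Section Bimodules.
Variables (K : fieldType) (A : algType K).

Record bimodule := Bimodule {
  bim_mod :> lmodType K;
  lact : A -> bim_mod -> bim_mod;
  ract : bim_mod -> A -> bim_mod;
  lact_bilinear : bilinear_map lact;
  ract_bilinear : bilinear_map ract;
  lact1 x : lact 1 x = x;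
  ract1 x : ract x 1 = x;
  lactM a b x : lact (a * b) x = lact a (lact b x);
  ractM x a b : ract x (a * b) = ract (ract x a) b;
  lractA a x b : ract (lact a x) b = lact a (ract x b)
}.

Record bimodHom (M N : bimodule) := BimodHom {
  bimod_fun :> {linear M -> N};
  bimod_lact a x : bimod_fun (lact a x) = lact a (bimod_fun x);
  bimod_ract x a : bimod_fun (ract x a) = ract (bimod_fun x) a
}.

Record subBimod (M : bimodule) := SubBimod {
  subBimod_pred : {pred M};
  subBimod_submod : submod_closed subBimod_pred;
  subBimod_lact a x : x \in subBimod_pred -> lact a x \in subBimod_pred;
  subBimod_ract x a : x \in subBimod_pred -> ract x a \in subBimod_pred
}.
Coercion subBimod_pred : subBimod >-> pred_sort.

HB.instance Definition _ (M : bimodule) (W : subBimod M) :=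
  GRing.isSubmodClosed.Build K M (subBimod_pred W)
    (GRing.submod_closed_semi (subBimod_submod W)).

Section Quotient.
Variables (M : bimodule) (W : subBimod M).
Local Notation Q := (lquot (subBimod_pred W)).
Local Notation pi := (lproj (subBimod_pred W)).

Definition quot_lact (a : A) : Q -> Q := qlift (fun x => pi (lact a x)).
Definition quot_ract (x : Q) (a : A) : Q := qlift (fun x => pi (ract x a)) x.

Lemma quot_lact_proj a x : quot_lact a (pi x) = pi (lact a x).
Proof.
apply: qlift_proj => [k y z|y Wy].
  by rewrite (lact_bilinear M).1 linearP.
by apply/lproj_eq0/subBimod_lact.
Qed.

Lemma quot_ract_proj a x : quot_ract (pi x) a = pi (ract x a).
Proof.
apply: (qlift_proj (f := fun x => pi (ract x a))) => [k y z|y Wy].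
  by rewrite (ract_bilinear M).2 linearP.
by apply/lproj_eq0/subBimod_ract.
Qed.

Definition quot_bimod : bimodule.
Proof.
apply: (@Bimodule Q quot_lact quot_ract).
- split=> [a k x y|x k a b].
    have [{}x ->] := lproj_surj x; have [{}y ->] := lproj_surj y.
    by rewrite -linearP !quot_lact_proj (lact_bilinear M).1 linearP.
  have [{}x ->] := lproj_surj x.
  by rewrite !quot_lact_proj (lact_bilinear M).2 linearP.
- split=> [x k a b|a k x y].
    have [{}x ->] := lproj_surj x.
    by rewrite !quot_ract_proj (ract_bilinear M).1 linearP.
  have [{}x ->] := lproj_surj x; have [{}y ->] := lproj_surj y.
  by rewrite -linearP !quot_ract_proj (ract_bilinear M).2 linearP.
- by move=> x; have [{}x ->] := lproj_surj x; rewrite quot_lact_proj lact1.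
- by move=> x; have [{}x ->] := lproj_surj x; rewrite quot_ract_proj ract1.
- by move=> a b x; have [{}x ->] := lproj_surj x; rewrite !quot_lact_proj lactM.
- by move=> x a b; have [{}x ->] := lproj_surj x; rewrite !quot_ract_proj ractM.
- move=> a x b; have [{}x ->] := lproj_surj x.
  by rewrite quot_lact_proj !quot_ract_proj quot_lact_proj lractA.
Defined.

Definition quot_hom : bimodHom M quot_bimod :=
  @BimodHom M quot_bimod pi
    (fun a x => esym (quot_lact_proj a x)) (fun x a => esym (quot_ract_proj a x)).
End Quotient.

Section Kernels.
Variables M N : bimodule.

Fact ker_submod_closed (f : bimodHom M N) : submod_closed [pred x | f x == 0].
Proof.
split=> [|k x y]; rewrite !inE ?raddf0 // => /eqP fx /eqP fy.
by rewrite linearP fx fy scaler0 addr0.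
Qed.

Fact ker_lact (f : bimodHom M N) a x :
  x \in [pred x | f x == 0] -> lact a x \in [pred x | f x == 0].
Proof.
rewrite !inE bimod_lact => /eqP ->.
by have := (lact_bilinear N).1 a (-1) 0 0; rewrite !scaleN1r oppr0 addr0 addNr => ->.
Qed.

Fact ker_ract (f : bimodHom M N) x a :
  x \in [pred x | f x == 0] -> ract x a \in [pred x | f x == 0].
Proof.
rewrite !inE bimod_ract => /eqP ->.
by have := (ract_bilinear N).2 a (-1) 0 0; rewrite !scaleN1r oppr0 addr0 addNr => ->.
Qed.

Definition kerB (f : bimodHom M N) : subBimod M :=
  SubBimod (ker_submod_closed f) (@ker_lact f) (@ker_ract f).

Definition sub_hom (f g : bimodHom M N) : bimodHom M N.
Proof.
apply: (@BimodHom M N (bimod_fun f \- bimod_fun g)) => [a x|x a] /=.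
  rewrite !bimod_lact; have := (lact_bilinear N).1 a (-1) (g x) (f x).
  by rewrite !scaleN1r ![- _ + _]addrC => ->.
rewrite !bimod_ract; have := (ract_bilinear N).2 a (-1) (g x) (f x).
by rewrite !scaleN1r ![- _ + _]addrC => ->.
Defined.
End Kernels.

Definition id_hom (M : bimodule) : bimodHom M M :=
  @BimodHom M M idfun (fun _ _ => erefl) (fun _ _ => erefl).

Section TensorOverA.
Variables M N : bimodule.

Lemma id_lin (V : lmodType K) : linear (@id V). Proof. by []. Qed.
Let ll a := (lact_bilinear M).1 a.
Let rl a := (ract_bilinear N).2 a.

Definition tprod_lact (a : A) : M \ox N -> M \ox N := tmap (lact a) id.
Definition tprod_ract (x : M \ox N) (a : A) : M \ox N :=
  tmap id (fun n => ract n a) x.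

Definition tprod_bimod : bimodule.
Proof.
apply: (@Bimodule (M \ox N)%type tprod_lact tprod_ract); rewrite /tprod_lact /tprod_ract.
- split=> [a|x k a b]; first exact: tmap_linear (ll a) (@id_lin _).
  apply: (tens_ext (f := tmap (lact (k *: a + b)) id)
    (g := fun x => k *: tmap (lact a) id x + tmap (lact b) id x)) => [||m n].
  + exact: tmap_linear (ll _) (@id_lin _).
  + move=> l z z'; rewrite !(tmap_linear (ll _) (@id_lin _)).
    by rewrite !scalerDr !scalerA mulrC addrACA.
  by rewrite !(tmap_tens _ _ (ll _) (@id_lin _)) (lact_bilinear M).2 (tens_bilinear _ _).2.
- split=> [x k a b|a]; last exact: tmap_linear (@id_lin _) (rl a).
  move: x; apply: (tens_ext (f := tmap id (fun n => ract n (k *: a + b)))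
    (g := fun x => k *: tmap id (fun n => ract n a) x
                + tmap id (fun n => ract n b) x)) => [||m n].
  + exact: tmap_linear (@id_lin _) (rl _).
  + move=> l z z'; rewrite !(tmap_linear (@id_lin _) (rl _)).
    by rewrite !scalerDr !scalerA mulrC addrACA.
  by rewrite !(tmap_tens _ _ (@id_lin _) (rl _)) (ract_bilinear N).1 (tens_bilinear _ _).1.
- apply: tens_ext => [||m n] //; first exact: tmap_linear (ll _) (@id_lin _).
  by rewrite !(tmap_tens _ _ (ll _) (@id_lin _)) lact1.
- apply: tens_ext => [||m n] //; first exact: tmap_linear (@id_lin _) (rl _).
  by rewrite !(tmap_tens _ _ (@id_lin _) (rl _)) ract1.
- move=> a b; apply: tens_ext => [||m n]; first exact: tmap_linear (ll _) (@id_lin _).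
    by move=> k x y; rewrite !(tmap_linear (ll _) (@id_lin _)).
  by rewrite !(tmap_tens _ _ (ll _) (@id_lin _)) lactM.
- move=> x a b; move: x.
  apply: (tens_ext (f := tmap id (fun n => ract n (a * b)))
    (g := fun x => tmap id (fun n => ract n b) (tmap id (fun n => ract n a) x))) => [||m n].
  + exact: tmap_linear (@id_lin _) (rl _).
  + by move=> k x y; rewrite !(tmap_linear (@id_lin _) (rl _)).
  by rewrite !(tmap_tens _ _ (@id_lin _) (rl _)) ractM.
move=> a x b; move: x.
apply: (tens_ext (f := fun x => tmap id (fun n => ract n b) (tmap (lact a) id x))
  (g := fun x => tmap (lact a) id (tmap id (fun n => ract n b) x))) => [||m n].
- by move=> k x y; rewrite (tmap_linear (ll _) (@id_lin _)) (tmap_linear (@id_lin _) (rl _)).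
- by move=> k x y; rewrite (tmap_linear (@id_lin _) (rl _)) (tmap_linear (ll _) (@id_lin _)).
by rewrite !(tmap_tens _ _ (ll _) (@id_lin _), tmap_tens _ _ (@id_lin _) (rl _)).
Defined.

Lemma lact_tens a m n : lact a (m \ox n : tprod_bimod) = lact a m \ox n.
Proof. exact: tmap_tens (ll a) (@id_lin _). Qed.

Lemma ract_tens m n a : ract (m \ox n : tprod_bimod) a = m \ox ract n a.
Proof. exact: tmap_tens (@id_lin _) (rl a). Qed.

(* M ⊗_A N is the quotient of M ⊗_K N by the span of ma ⊗ n - m ⊗ an. *)
Inductive balanced_rel : tprod_bimod -> Prop :=
| Balanced m a n : balanced_rel (ract m a \ox n - m \ox lact a n).

Fact balanced_lact a x : x \in lspan balanced_rel -> lact a x \in lspan balanced_rel.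
Proof.
have lin := (lact_bilinear tprod_bimod).1 a.
move: x; apply: lspan_min => [|k x y Wx Wy|_ [m b n]].
- have := lin (-1) 0 0; rewrite !scaleN1r oppr0 addr0 addNr => ->.
  exact: rpred0.
- by rewrite lin rpredD ?rpredZ.
apply: mem_lspan; have := lin (-1) (m \ox lact b n) (ract m b \ox n).
rewrite !scaleN1r ![- _ + _]addrC => ->.
rewrite !lact_tens -lractA.
exact: Balanced.
Qed.

Fact balanced_ract x a : x \in lspan balanced_rel -> ract x a \in lspan balanced_rel.
Proof.
have lin := (ract_bilinear tprod_bimod).2 a.
move: x; apply: lspan_min => [|k x y Wx Wy|_ [m b n]].
- have := lin (-1) 0 0; rewrite !scaleN1r oppr0 addr0 addNr => ->.
  exact: rpred0.
- by rewrite lin rpredD ?rpredZ.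
apply: mem_lspan; have := lin (-1) (m \ox lact b n) (ract m b \ox n).
rewrite !scaleN1r ![- _ + _]addrC => ->.
rewrite !ract_tens lractA.
exact: Balanced.
Qed.

Definition balanced_subBimod : subBimod tprod_bimod :=
  SubBimod (lspan_submod_closed balanced_rel) balanced_lact balanced_ract.

Definition tprodA : bimodule := quot_bimod balanced_subBimod.
Definition tensA (m : M) (n : N) : tprodA := quot_hom balanced_subBimod (m \ox n).

(* Meaningful only for bilinear f with f (ma) n = f m (an), see tliftA_tensA. *)
Definition tliftA (P : lmodType K) (f : M -> N -> P) : tprodA -> P :=
  qlift (tlift f).

Lemma tensA_bilinear : bilinear_map tensA.
Proof.
by split=> [m|n] k x y; rewrite /tensA -linearP ?(tens_bilinear _ _).1 ?(tens_bilinear _ _).2.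
Qed.

Lemma tensA_balanced m a n : tensA (ract m a) n = tensA m (lact a n).
Proof. exact/lproj_eq/mem_lspan/Balanced. Qed.

Lemma lact_tensA a m n : lact a (tensA m n) = tensA (lact a m) n.
Proof. by rewrite /tensA -bimod_lact lact_tens. Qed.

Lemma ract_tensA a m n : ract (tensA m n) a = tensA m (ract n a).
Proof. by rewrite /tensA -bimod_ract ract_tens. Qed.

Section TliftATheory.
Variables (P : lmodType K) (f : M -> N -> P).
Hypothesis f_bil : bilinear_map f.
Hypothesis f_bal : forall m a n, f (ract m a) n = f m (lact a n).

Let f_rel x : x \in lspan balanced_rel -> tlift f x = 0.
Proof.
pose F : {linear (M \ox N)%type -> P} :=
  HB.pack (tlift f) (GRing.isLinear.Build _ _ _ _ _ (tlift_linear f_bil)).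
rewrite -[tlift f]/(F : _ -> _).
move: x; apply: lspan_min => [|k x y Fx Fy|_ [m a n]]; first exact: raddf0.
  by rewrite linearP Fx Fy scaler0 addr0.
by rewrite raddfB /= !tlift_tens // f_bal subrr.
Qed.

Lemma tliftA_tensA m n : tliftA f (tensA m n) = f m n.
Proof.
rewrite -(tlift_tens f_bil); apply: qlift_proj f_rel _.
exact: tlift_linear.
Qed.

Lemma tliftA_linear : linear (tliftA f).
Proof. by apply: qlift_linear f_rel; apply: tlift_linear. Qed.
End TliftATheory.

End TensorOverA.
End Bimodules.

Section Subspaces.
Variables (K : fieldType) (V : lmodType K).

Definition is_basis n (b : 'I_n -> V) (U : {pred V}) : Prop :=
  [/\ forall i, b i \in U,
      forall c : 'I_n -> K, \sum_i c i *: b i = 0 -> forall i, c i = 0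
    & forall x, x \in U -> exists c : 'I_n -> K, x = \sum_i c i *: b i].

Definition finite_dimensional (U : {pred V}) : Prop :=
  exists n (b : 'I_n -> V), is_basis b U.

(* The restriction of f to U has a basis of eigenvectors. The basis is finite:
   U is meant to be a finite-dimensional space of invariants. *)
Definition diagonalisable_on (f : V -> V) (U : {pred V}) : Prop :=
  exists n (b : 'I_n -> V),
    is_basis b U /\ forall i, exists l : K, f (b i) = l *: b i.

Definition direct_sum (U W : {pred V}) : Prop :=
  (forall x, exists u w, [/\ u \in U, w \in W & x = u + w]) /\
  (forall x, x \in U -> x \in W -> x = 0).
End Subspaces.

Definition right_module_iso_on (K : fieldType) (A : algType K)
    (M N : bimodule A) (F : {pred M}) (f : M -> N) : Prop :=
  [/\ forall (k : K) x y, x \in F -> y \in F -> f (k *: x + y) = k *: f x + f y,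
      forall x a, x \in F -> f (ract x a) = ract (f x) a,
      {in F &, injective f}
    & forall y, exists2 x, x \in F & f x = y].

Record calculus (K : fieldType) (A : algType K) := Calculus {
  calc_bimod :> bimodule A;
  diff : {linear A -> calc_bimod};
  diffM a b : diff (a * b) = ract (diff a) b + lact a (diff b);
  diff_span x :
    exists s : seq (A * A), x = \sum_(p <- s) lact p.1 (diff p.2)
}.
Arguments diff {K A c}.

Section Calculus.
Variables (K : fieldType) (A : hopfAlgebra K) (E : calculus A).

(* A list s of pairs (a_k, b_k) presents the form \sum_k a_k d b_k; lcoact_sum s
   is \sum_k Delta(a_k) (id ⊗ d)Delta(b_k), and symmetrically for rcoact_sum. *)
Definition lcoact_sum (s : seq (A * A)) : (A \ox E)%type :=
  \sum_(p <- s)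
    tmap2 *%R (@lact _ _ E) (comul p.1) (tmap id diff (comul p.2)).

Definition rcoact_sum (s : seq (A * A)) : (E \ox A)%type :=
  \sum_(p <- s)
    tmap2 (@lact _ _ E) *%R (comul p.1) (tmap diff id (comul p.2)).

Definition bicovariant : Prop := forall s : seq (A * A),
  \sum_(p <- s) lact p.1 (diff p.2) = 0 :> E ->
  lcoact_sum s = 0 /\ rcoact_sum s = 0.

(* The coactions use a chosen presentation of x. For a bicovariant calculus the
   choice does not matter (lcoact_sumE, rcoact_sumE), and they extend
   (id ⊗ d)Delta and (d ⊗ id)Delta (lcoact_diff, rcoact_diff). *)
Definition lcoact (x : E) : (A \ox E)%type := lcoact_sum (sval (cid (diff_span x))).
Definition rcoact (x : E) : (E \ox A)%type := rcoact_sum (sval (cid (diff_span x))).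

Let mul_bil : bilinear_map (@GRing.mul A : A -> A -> A).
Proof.
by split=> a k b c; rewrite ?mulrDr ?mulrDl -?scalerAl -?scalerAr.
Qed.
Let d_lin : linear (diff : A -> E).
Proof. exact: linearP. Qed.
Let i_lin : linear (id : A -> A).
Proof. by []. Qed.
Let lactE := lact_bilinear E.
Let ractE := ract_bilinear E.

Lemma bicovariant_sum (s t : seq (A * A)) : bicovariant ->
  \sum_(p <- s) lact p.1 (diff p.2) = \sum_(p <- t) lact p.1 (diff p.2) :> E ->
  lcoact_sum s = lcoact_sum t /\ rcoact_sum s = rcoact_sum t.
Proof.
move=> bic st; pose t' := [seq (- p.1, p.2) | p <- t].
have bilN (U V W : lmodType K) (f : U -> V -> W) u v :
    bilinear_map f -> f (- u) v = - f u v.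
  move=> fb; have f0 : f 0 v = 0.
    by have := fb.2 v (-1) 0 0; rewrite !scaleN1r oppr0 addr0 addNr.
  by have := fb.2 v (-1) u 0; rewrite !scaleN1r addr0 f0 addr0.
have [|] := bic (s ++ t').
  rewrite big_cat big_map /= st -big_split big1 //= => p _.
  by rewrite (bilN _ _ _ _ _ _ lactE) subrr.
rewrite /lcoact_sum /rcoact_sum !big_cat !big_map /=.
under [X in _ + X = 0 -> _]eq_bigr => p _.
  rewrite raddfN (bilN _ _ _ _ _ _ (tmap2_bilinear mul_bil lactE)); over.
under [X in _ -> _ + X = 0 -> _]eq_bigr => p _.
  rewrite raddfN (bilN _ _ _ _ _ _ (tmap2_bilinear lactE mul_bil)); over.
by rewrite !sumrN => /subr0_eq -> /subr0_eq ->.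
Qed.

Lemma lcoact_sumE s : bicovariant ->
  lcoact (\sum_(p <- s) lact p.1 (diff p.2)) = lcoact_sum s.
Proof.
by move=> bic; rewrite /lcoact; case: cid => t /= /esym/(bicovariant_sum bic)[].
Qed.

Lemma rcoact_sumE s : bicovariant ->
  rcoact (\sum_(p <- s) lact p.1 (diff p.2)) = rcoact_sum s.
Proof.
by move=> bic; rewrite /rcoact; case: cid => t /= /esym/(bicovariant_sum bic)[].
Qed.


Lemma lcoact_linear : bicovariant -> linear lcoact.
Proof.
move=> bic k x y; have [s ->] := diff_span x; have [t ->] := diff_span y.
have -> : k *: \sum_(p <- s) lact p.1 (diff p.2)
    + \sum_(p <- t) lact p.1 (diff p.2) = \sum_(p <- [seq (k *: p.1, p.2) | p <- s] ++ t)
    lact p.1 (diff p.2) :> E.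
  rewrite big_cat big_map scaler_sumr /=; congr (_ + _); apply: eq_bigr => p _.
  have := lactE.2 (diff p.2) k p.1 0; have := lactE.2 (diff p.2) (-1) 0 0.
  by rewrite !scaleN1r oppr0 addr0 addNr => ->; rewrite !addr0 => ->.
rewrite !lcoact_sumE // /lcoact_sum big_cat big_map scaler_sumr /=; congr (_ + _).
apply: eq_bigr => p _; rewrite linearZ.
set z := tmap _ _ _; have B := tmap2_bilinear mul_bil lactE.
have := B.2 z k (comul p.1) 0; have := B.2 z (-1) 0 0.
by rewrite !scaleN1r oppr0 addr0 addNr => ->; rewrite !addr0 => ->.
Qed.

Lemma lcoact_lact a x : bicovariant ->
  lcoact (lact a x) = tmap2 *%R (@lact _ _ E) (comul a) (lcoact x).
Proof.
move=> bic; have [s ->] := diff_span x.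
have B := tmap2_bilinear mul_bil lactE.
pose F : {linear E -> E} := HB.pack (lact a) (GRing.isLinear.Build _ _ _ _ _ (lactE.1 a)).
pose G : {linear (A \ox E)%type -> (A \ox E)%type} :=
  HB.pack (tmap2 *%R (@lact _ _ E) (comul a)) (GRing.isLinear.Build _ _ _ _ _ (B.1 (comul a))).
rewrite -[lact a]/(F : _ -> _) -[tmap2 _ _ _]/(G : _ -> _).
rewrite lcoact_sumE // /lcoact_sum !raddf_sum /=.
have -> : \sum_(p <- s) lact a (lact p.1 (diff p.2)) =
  \sum_(p <- [seq (a * p.1, p.2) | p <- s]) lact p.1 (diff p.2) :> E.
  by rewrite big_map; apply: eq_bigr => p _; rewrite lactM.
rewrite lcoact_sumE // /lcoact_sum big_map; apply: eq_bigr => p _ /=.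
rewrite comulM (tmap2A _ _ _ mul_bil mul_bil mul_bil mul_bil lactE mul_bil lactE lactE) //.
- by move=> *; rewrite mulrA.
- by move=> *; rewrite lactM.
Qed.

Lemma lcoact_diff a : bicovariant -> lcoact (diff a) = tmap id diff (comul a).
Proof.
move=> bic; have -> : diff a = \sum_(p <- [:: (1, a)]) lact p.1 (diff p.2) :> E.
  by rewrite big_seq1 lact1.
rewrite lcoact_sumE // /lcoact_sum big_seq1 /= comul1.
move: (tmap _ _ _); apply: tens_ext => [||b x] //.
  exact: (tmap2_bilinear mul_bil lactE).1.
by rewrite (tmap2_tens _ _ _ _ mul_bil lactE) mul1r lact1.
Qed.

Lemma lcoact_ract x a : bicovariant ->
  lcoact (ract x a) = tmap2 *%R (@ract _ _ E) (lcoact x) (comul a).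
Proof.
move=> bic; have [s ->] := diff_span x.
have B := tmap2_bilinear mul_bil ractE; have B' := tmap2_bilinear mul_bil lactE.
pose F : {linear E -> E} := HB.pack (fun x : E => ract x a)
  (GRing.isLinear.Build _ _ _ _ _ (ractE.2 a)).
pose G : {linear (A \ox E)%type -> (A \ox E)%type} :=
  HB.pack (fun x => tmap2 *%R (@ract _ _ E) x (comul a))
    (GRing.isLinear.Build _ _ _ _ _ (B.2 (comul a))).
pose H : {linear E -> (A \ox E)%type} :=
  HB.pack lcoact (GRing.isLinear.Build _ _ _ _ _ (lcoact_linear bic)).
rewrite -[LHS]/(H (F _)) -[RHS]/(G (H _)).
have HS (f : A * A -> E) : H (\sum_(p <- s) f p) = \sum_(p <- s) H (f p).
  exact: (raddf_sum H).
rewrite (raddf_sum F) !HS (raddf_sum G); apply: eq_bigr => -[b c] _ /=.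
rewrite lractA.
have -> : ract (diff c) a = diff (c * a) - lact c (diff a) :> E by rewrite diffM addrK.
pose F' : {linear E -> E} := HB.pack (lact b) (GRing.isLinear.Build _ _ _ _ _ (lactE.1 b)).
pose G' : {linear (A \ox E)%type -> (A \ox E)%type} :=
  HB.pack (tmap2 *%R (@lact _ _ E) (comul b)) (GRing.isLinear.Build _ _ _ _ _ (B'.1 (comul b))).
rewrite -[LHS]/(H (F' _)) (raddfB F') (raddfB H) /= !lcoact_lact // !lcoact_diff //.
rewrite -[_ - _]/(G' _ - G' _) -(raddfB G') /=.
rewrite [RHS](tmap2A _ _ _ mul_bil mul_bil mul_bil mul_bil ractE lactE lactE ractE).
- congr tmap2; rewrite comulM; apply/eqP; rewrite subr_eq; apply/eqP.
  have D := tmap_linear i_lin d_lin; have C := tmap2_bilinear mul_bil mul_bil.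
  move: (comul c); apply: tens_ext => [k u v|k u v|m n].
  + by rewrite C.2 D.
  + by rewrite D B.2 B'.2 !scalerDr addrACA.
  move: (comul a).
  apply: (tens_ext (f := fun y => tmap id diff (tmap2 *%R *%R (m \ox n) y))
   (g := fun y => tmap2 *%R (@ract _ _ E) (tmap id diff (m \ox n)) y
            + tmap2 *%R (@lact _ _ E) (m \ox n) (tmap id diff y))) => [k u v|k u v|m' n'].
  + by rewrite C.1 D.
  + by rewrite D B.1 B'.1 !scalerDr addrACA.
  rewrite !(tmap_tens _ _ i_lin d_lin) (tmap2_tens _ _ _ _ mul_bil mul_bil).
  rewrite (tmap2_tens _ _ _ _ mul_bil lactE) (tmap2_tens _ _ _ _ mul_bil ractE).
  by rewrite (tmap_tens _ _ i_lin d_lin) diffM -[ract _ _]scale1r (tens_bilinear _ _).1 !scale1r.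
- by move=> *; rewrite mulrA.
- by move=> *; rewrite lractA.
Qed.

Lemma rcoact_lact a x : bicovariant ->
  rcoact (lact a x) = tmap2 (@lact _ _ E) *%R (comul a) (rcoact x).
Proof.
move=> bic; have [s ->] := diff_span x.
have B := tmap2_bilinear lactE mul_bil.
pose F : {linear E -> E} := HB.pack (lact a) (GRing.isLinear.Build _ _ _ _ _ (lactE.1 a)).
pose G : {linear (E \ox A)%type -> (E \ox A)%type} :=
  HB.pack (tmap2 (@lact _ _ E) *%R (comul a)) (GRing.isLinear.Build _ _ _ _ _ (B.1 (comul a))).
rewrite -[lact a]/(F : _ -> _) -[tmap2 _ _ _]/(G : _ -> _).
rewrite rcoact_sumE // /rcoact_sum !raddf_sum /=.
have -> : \sum_(p <- s) lact a (lact p.1 (diff p.2)) =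
  \sum_(p <- [seq (a * p.1, p.2) | p <- s]) lact p.1 (diff p.2) :> E.
  by rewrite big_map; apply: eq_bigr => p _; rewrite lactM.
rewrite rcoact_sumE // /rcoact_sum big_map; apply: eq_bigr => p _ /=.
rewrite comulM (tmap2A _ _ _ lactE mul_bil lactE lactE mul_bil mul_bil mul_bil mul_bil) //.
- by move=> *; rewrite lactM.
- by move=> *; rewrite mulrA.
Qed.

Lemma rcoact_diff a : bicovariant -> rcoact (diff a) = tmap diff id (comul a).
Proof.
move=> bic; have -> : diff a = \sum_(p <- [:: (1, a)]) lact p.1 (diff p.2) :> E.
  by rewrite big_seq1 lact1.
rewrite rcoact_sumE // /rcoact_sum big_seq1 /= comul1.
move: (tmap _ _ _); apply: tens_ext => [||x b] //.
  exact: (tmap2_bilinear lactE mul_bil).1.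
by rewrite (tmap2_tens _ _ _ _ lactE mul_bil) mul1r lact1.
Qed.

End Calculus.
Arguments lcoact_sum {K A} E s.
Arguments rcoact_sum {K A} E s.
Arguments lcoact {K A} E x.
Arguments rcoact {K A} E x.

Section Invariants.
Variables (K : fieldType) (A : hopfAlgebra K).

Definition linv (M : lmodType K) (dM : M -> (A \ox M)%type) : {pred M} :=
  [pred m | dM m == 1 \ox m].

Definition rinv (M : lmodType K) (dM : M -> (M \ox A)%type) : {pred M} :=
  [pred m | dM m == m \ox 1].

(* m ⊗ n |-> m_(-1) n_(-1) ⊗ (m_(0) ⊗ n_(0)), see lcoact2_tensA. *)
Definition diag_lcoact (M N : bimodule A)
    (dM : M -> (A \ox M)%type) (dN : N -> (A \ox N)%type) :
    tprodA M N -> (A \ox tprodA M N)%type :=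
  tliftA (fun m n => tmap2 *%R (@tensA _ _ M N) (dM m) (dN n)).
End Invariants.

Section Braiding.
Variables (K : fieldType) (A : hopfAlgebra K) (E : calculus A).
Local Notation E2 := (tprodA E E).

(* Woronowicz's canonical braiding: the unique such bimodule map. *)
Definition is_braiding (sigma : bimodHom E2 E2) : Prop :=
  forall omega eta : E, omega \in linv (lcoact E) ->
    eta \in rinv (rcoact E) ->
    sigma (tensA omega eta) = tensA eta omega.

Definition lcoact2 : E2 -> (A \ox E2)%type :=
  diag_lcoact (lcoact E) (lcoact E).

Lemma lcoact2_tensA (x y : E) : bicovariant E ->
  lcoact2 (tensA x y) = tmap2 *%R (@tensA _ _ E E) (lcoact E x) (lcoact E y).
Proof.
move=> bic; have mul_bil : bilinear_map (@GRing.mul A : A -> A -> A).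
  by split=> a k b c; rewrite ?mulrDr ?mulrDl -?scalerAl -?scalerAr.
have B := tmap2_bilinear mul_bil (tensA_bilinear E E).
have cl := lcoact_linear bic.
apply: (tliftA_tensA (f := fun x y =>
  tmap2 *%R (@tensA _ _ E E) (lcoact E x) (lcoact E y))) => [|m a n].
  by split=> [m|n] k u v; rewrite cl ?B.1 ?B.2.
rewrite lcoact_ract // lcoact_lact //.
apply: (tmap2A _ _ _ mul_bil mul_bil mul_bil mul_bil (tensA_bilinear E E)
  (ract_bilinear E) (tensA_bilinear E E) (lact_bilinear E)) => [b c e|m' b n'].
  by rewrite mulrA.
exact: tensA_balanced.
Qed.

Variable sigma : bimodHom E2 E2.

(* Ker(sigma - 1) is the kernel of a bimodule map, hence a sub-bimodule. *)
Definition Omega2 : bimodule A := quot_bimod (kerB (sub_hom sigma (id_hom E2))).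
Definition wedge : bimodHom E2 Omega2 := quot_hom (kerB (sub_hom sigma (id_hom E2))).
End Braiding.
Arguments lcoact2 {K A} E _.

(* Main.v *)
(* Every form is a sum of terms a ω with ω left-invariant: the forms
   π(b) = S(b_(1)) d b_(2) are left-invariant and d b = b_(1) π(b_(2)). Hence
   E ⊗_A E is generated as a left module by the left-invariant tensors ω ⊗ η, so
   by the eigenvectors of σ among them; as σ is left linear, every element of
   E ⊗_A E is a finite sum of eigenvectors of σ. An operator with this property
   satisfies V = Ker(σ - 1) ⊕ Im(σ - 1), and F = Im(σ - 1) is a sub-bimodule. *)

From HB Require Import structures.
Require Import Defs.
From mathcomp Require Import all_boot all_algebra.
From mathcomp Require Import boolp reals complex.

Set Implicit Arguments.
Unset Strict Implicit.
Unset Printing Implicit Defensive.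

Import GRing.Theory.
Local Open Scope ring_scope.

(** * Linearity as a property of bare functions *)

Section LinearFunctions.
Variables (K : fieldType) (V W : lmodType K) (f : V -> W).

Lemma linear_sumE (I : Type) (r : seq I) (F : I -> V) :
  linear f -> f (\sum_(i <- r) F i) = \sum_(i <- r) f (F i).
Proof.
move=> fl; pose g : {linear V -> W} := HB.pack f (GRing.isLinear.Build K V W *:%R f fl).
exact: (linear_sum g).
Qed.

Lemma linear_scaleE k x : linear f -> f (k *: x) = k *: f x.
Proof.
move=> fl; pose g : {linear V -> W} := HB.pack f (GRing.isLinear.Build K V W *:%R f fl).
exact: (linearZZ g).
Qed.

End LinearFunctions.
Arguments linear_sumE {K V W f I r F} _.
Arguments linear_scaleE {K V W f k x} _.

(** * Finite sums of eigenvectors *)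

Section Eigenvectors.
Variables (K : fieldType) (V : lmodType K).

(** Pairs are (eigenvalue, vector). Repeated eigenvalues and zero vectors are allowed, so that
    concatenating lists proves closure under addition. *)
Definition eigensum (f : V -> V) (x : V) : Prop :=
  exists2 s : seq (K * V),
    {in s, forall p, f p.2 = p.1 *: p.2} & x = \sum_(p <- s) p.2.

Lemma eigensum0 f : eigensum f 0.
Proof. by exists [::]; rewrite ?big_nil. Qed.

Lemma eigensumD f x y : eigensum f x -> eigensum f y -> eigensum f (x + y).
Proof.
move=> [s fs ->] [t ft ->]; exists (s ++ t); last by rewrite big_cat.
by move=> p; rewrite mem_cat => /orP[/fs|/ft].
Qed.

Lemma eigensum_sum f (I : Type) (r : seq I) (P : pred I) (F : I -> V) :
  (forall i, P i -> eigensum f (F i)) -> eigensum f (\sum_(i <- r | P i) F i).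
Proof.
by move=> fF; apply: big_ind => // [|x y]; [apply: eigensum0|apply: eigensumD].
Qed.

(* Applying [f - p.1] for the first eigenvector [p] gives
   [(1 - p.1) *: x] as a sum of one eigenvector fewer. *)
Lemma fixed_eigensum_eq0 (f : {linear V -> V}) (s : seq (K * V)) x :
  {in s, forall p, f p.2 = p.1 *: p.2 /\ p.1 != 1} ->
  x = \sum_(p <- s) p.2 -> f x = x -> x = 0.
Proof.
have [n] := ubnP (size s); elim: n => // n IHn in s x *.
case: s => [|p s] /= ltsn fs xE fx; first by rewrite xE big_nil.
have [fp p1] := fs p (mem_head _ _).
have : (1 - p.1) *: x = 0.
  (* Here [s] is the tail. Further entries with eigenvalue [p.1] become zero but stay in the list,
     so its length drops by exactly one. *)
  apply: (IHn [seq (q.1, (q.1 - p.1) *: q.2) | q <- s]).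
  - by rewrite size_map.
  - move=> _ /mapP[q sq ->] /=.
    have [fq q1] := fs q (mem_behead (s := p :: s) sq).
    by rewrite linearZ /= fq !scalerA mulrC.
  - rewrite big_map scalerBl scale1r -{1}fx xE big_cons linearD linear_sum /= fp.
    rewrite scalerDr opprD addrACA subrr add0r scaler_sumr -sumrB /=.
    apply: eq_big_seq => q sq; rewrite (fs q (mem_behead (s := p :: s) sq)).1.
    by rewrite scalerBl.
  - by rewrite linearZ /= fx.
by move/eqP; rewrite scaler_eq0 subr_eq0 eq_sym (negPf p1) => /eqP.
Qed.

(** The eigenvectors for 1 add up to [u]. On one for l != 1 the map [f - 1] is multiplication by l -
    1, and dividing by this scalar gives [z]. *)
Lemma eigensum_split (f : {linear V -> V}) x : eigensum f x ->
  exists u z, f u = u /\ x = u + (f z - z).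
Proof.
case=> s fs ->; exists (\sum_(p <- s | p.1 == 1) p.2).
exists (\sum_(p <- s | p.1 != 1) (p.1 - 1)^-1 *: p.2); split.
  rewrite linear_sum big_seq_cond [RHS]big_seq_cond; apply: eq_bigr => p.
  by case/andP=> sp /eqP p1; rewrite fs // p1 scale1r.
rewrite (bigID (fun p => p.1 == 1)) /=; congr (_ + _).
rewrite linear_sum -sumrB big_seq_cond [RHS]big_seq_cond; apply: eq_bigr => p.
case/andP=> sp p1; rewrite linearZ /= fs // -scalerBr -{3}[p.2]scale1r -scalerBl.
by rewrite scalerA mulVf ?scale1r // subr_eq0.
Qed.

(** The map [f - 1] kills the eigenvectors for 1 and rescales the others, so [f z - z] is a sum of
    eigenvectors with eigenvalues other than 1, to which [fixed_eigensum_eq0] applies. *)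
Lemma eigensum_ker_im (f : {linear V -> V}) z : eigensum f z ->
  f (f z - z) = f z - z -> f z - z = 0.
Proof.
case=> s fs zE.
apply: (@fixed_eigensum_eq0 f [seq (p.1, (p.1 - 1) *: p.2) | p <- s & p.1 != 1]).
  move=> q /mapP[p]; rewrite mem_filter => /andP[p1 sp] -> /=; split=> //.
  by rewrite linearZ /= fs // !scalerA mulrC.
rewrite big_map big_filter zE linear_sum -sumrB (bigID (fun p => p.1 == 1)) /=.
rewrite big_seq_cond big1 ?add0r => [|p /andP[sp /eqP p1]]; last first.
  by rewrite fs // p1 scale1r subrr.
rewrite big_seq_cond [RHS]big_seq_cond; apply: eq_bigr => p /andP[sp _].
by rewrite fs // scalerBl scale1r.
Qed.

End Eigenvectors.

(** * Convolution of linear maps out of a Hopf algebra *)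

Section Convolution.
Variables (K : fieldType) (A : hopfAlgebra K).

(** The convolution product, with [op] in place of the product of an algebra, so that module
    actions, scalings and [tens] can be used as well. *)
Definition conv (U V W : lmodType K) (op : U -> V -> W) (f : A -> U) (g : A -> V)
  (a : A) : W := tlift (fun b c => op (f b) (g c)) (comul a).

Lemma bilinear_comp (U V W U' V' : lmodType K) (op : U -> V -> W)
    (f : U' -> U) (g : V' -> V) :
  bilinear_map op -> linear f -> linear g ->
  bilinear_map (fun b c => op (f b) (g c)).
Proof.
by move=> opb fl gl; split=> [m|n] k x y; rewrite ?fl ?gl ?opb.1 ?opb.2.
Qed.

Lemma linear_compose (U V W : lmodType K) (f : V -> W) (g : U -> V) :
  linear f -> linear g -> linear (f \o g).
Proof. by move=> fl gl k x y /=; rewrite gl fl. Qed.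

Lemma conv_linear (U V W : lmodType K) (op : U -> V -> W) f g :
  bilinear_map op -> linear f -> linear g -> linear (conv op f g).
Proof.
move=> opb fl gl; apply: (linear_compose (f := tlift _) (g := comul)).
  exact/tlift_linear/bilinear_comp.
exact: linearP.
Qed.

Lemma tlift_comp (M N V W : lmodType K) (h : V -> W) (f : M -> N -> V) :
  linear h -> bilinear_map f -> h \o tlift f =1 tlift (fun m n => h (f m n)).
Proof.
move=> hl fb; have hfb : bilinear_map (fun m n => h (f m n)).
  by split=> [m|n] k x y; rewrite ?fb.1 ?fb.2 hl.
apply: tens_ext => [||m n /=]; last by rewrite !tlift_tens.
- exact: linear_compose (tlift_linear fb).
- exact: tlift_linear.
Qed.

Lemma linear_conv (U V W W' : lmodType K) (h : W -> W') (op : U -> V -> W) f g a :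
  linear h -> bilinear_map op -> linear f -> linear g ->
  h (conv op f g a) = conv (fun u v => h (op u v)) f g a.
Proof.
by move=> hl opb fl gl; apply: (tlift_comp hl); apply: bilinear_comp.
Qed.

Lemma conv_ext (U V W U' V' : lmodType K) (op : U -> V -> W) (op' : U' -> V' -> W)
    f g f' g' a :
  (forall b c, op (f b) (g c) = op' (f' b) (g' c)) ->
  conv op f g a = conv op' f' g' a.
Proof.
by move=> e; rewrite /conv; congr (tlift _ _); apply/funext=> b; apply/funext.
Qed.

Lemma tlift_tmap (M N M' N' W : lmodType K) (F : M' -> N' -> W)
    (f : M -> M') (g : N -> N') y :
  bilinear_map F -> linear f -> linear g ->
  tlift F (tmap f g y) = tlift (fun m n => F (f m) (g n)) y.
Proof.
move=> Fb fl gl; have Fb' := bilinear_comp Fb fl gl.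
move: y; apply: (tens_ext (f := fun y => tlift F (tmap f g y))
  (g := tlift (fun m n => F (f m) (g n)))) => [||m n].
- exact: linear_compose (tlift_linear Fb) (tmap_linear fl gl).
- exact: tlift_linear.
by rewrite tmap_tens // !tlift_tens.
Qed.

Lemma tlift_tassoc (M N P MN NP W : lmodType K) (op1 : MN -> P -> W)
    (op2 : M -> N -> MN) (op3 : M -> NP -> W) (op4 : N -> P -> NP) y :
  bilinear_map op1 -> bilinear_map op2 -> bilinear_map op3 -> bilinear_map op4 ->
  (forall u v w, op1 (op2 u v) w = op3 u (op4 v w)) ->
  tlift (fun x p => op1 (tlift op2 x) p) y =
  tlift (fun m z => op3 m (tlift op4 z)) (tassoc y).
Proof.
move=> b1 b2 b3 b4 opA.
have idl (V : lmodType K) : linear (@id V) by [].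
have B1 := bilinear_comp b1 (tlift_linear b2) (@idl P).
have B3 := bilinear_comp b3 (@idl M) (tlift_linear b4).
pose F1 x p := op1 (tlift op2 x) p; pose F3 m z := op3 m (tlift op4 z).
rewrite -/F1 -/F3 in B1 B3 *.
move: y; apply: (tens_ext (f := tlift F1) (g := fun y => tlift F3 (tassoc y))) => [||x p].
- exact: tlift_linear B1.
- exact: linear_compose (tlift_linear B3) (tlift_linear (tassoc_bilinear M N P)).
move: x; apply: (tens_ext (f := fun x => tlift F1 (x \ox p))
  (g := fun x => tlift F3 (tassoc (x \ox p)))) => [k x y|k x y|m n].
- by rewrite (tens_bilinear _ _).2 (tlift_linear B1).
- rewrite (tens_bilinear _ _).2 [tassoc _](tlift_linear (tassoc_bilinear M N P)).
  by rewrite (tlift_linear B3).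
rewrite tassoc_tens (tlift_tens B1) (tlift_tens B3) /F1 /F3.
by rewrite (tlift_tens b2) (tlift_tens b4) opA.
Qed.

Lemma tlift_id (M N : lmodType K) (x : (M \ox N)%type) : tlift (@tens K M N) x = x.
Proof.
have tb := tens_bilinear M N.
move: x; apply: (tens_ext (f := tlift (@tens K M N)) (g := id)) => [||m n] //.
  exact: tlift_linear.
by rewrite tlift_tens.
Qed.

(** The two sides are lifts evaluated at the two bracketings of the iterated coproduct, which
    coassociativity identifies. *)
Lemma convA (U V W UV VW T : lmodType K)
    (op1 : UV -> W -> T) (op2 : U -> V -> UV)
    (op3 : U -> VW -> T) (op4 : V -> W -> VW) f g h a :
  bilinear_map op1 -> bilinear_map op2 -> bilinear_map op3 -> bilinear_map op4 ->
  linear f -> linear g -> linear h ->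
  (forall u v w, op1 (op2 u v) w = op3 u (op4 v w)) ->
  conv op1 (conv op2 f g) h a = conv op3 f (conv op4 g h) a.
Proof.
move=> b1 b2 b3 b4 fl gl hl opA.
have idl (N : lmodType K) : linear (@id N) by [].
have cl : linear (comul : A -> (A \ox A)%type) by exact: linearP.
have c1 := bilinear_comp b1 (@idl _) hl; have c2 := bilinear_comp b2 fl gl.
have c3 := bilinear_comp b3 fl (@idl _); have c4 := bilinear_comp b4 gl hl.
have e1 := tlift_tmap (comul a) (bilinear_comp c1 (tlift_linear c2) (@idl _)) cl (@idl A).
have e3 := tlift_tmap (comul a) (bilinear_comp c3 (@idl _) (tlift_linear c4)) (@idl A) cl.
have e := tlift_tassoc (tmap comul id (comul a)) c1 c2 c3 c4
  (fun u v w => opA (f u) (g v) (h w)).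
rewrite comulA in e.
exact: etrans (esym e1) (etrans e e3).
Qed.

Lemma conv_counit (V : lmodType K) (g : A -> V) a : linear g ->
  conv (fun (k : K^o) v => k *: v) counit g a = g a.
Proof.
move=> gl; rewrite -[in RHS](counitL a).
have ll (W : lmodType K) : bilinear_map (fun (k : K^o) (v : W) => k *: v).
  by split=> [m|n] k x y; rewrite ?scalerDl ?scalerDr ?scalerA // mulrC.
have cl : linear (counit : A -> K^o) by exact: linearP.
rewrite [RHS](linear_conv (f := counit) (g := id) _ gl (ll A) cl) //.
apply: conv_ext => b c.
exact/esym/linear_scaleE.
Qed.

End Convolution.

(** * Left-invariant forms generate the calculus *)

Section LeftInvariantForms.
Variables (K : fieldType) (A : hopfAlgebra K) (E : calculus A).
Hypothesis E_bicov : bicovariant E.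

Local Notation AA := (A \ox A)%type.
Local Notation AE := (A \ox E)%type.

Let mulb : bilinear_map (@GRing.mul A : A -> A -> A).
Proof. by split=> a k b c; rewrite ?mulrDr ?mulrDl -?scalerAl -?scalerAr. Qed.
Let lactb := lact_bilinear E.
Let mul2b : bilinear_map (tmap2 *%R *%R : AA -> AA -> AA).
Proof. exact: tmap2_bilinear. Qed.
Let actb : bilinear_map (tmap2 *%R (@lact _ _ E) : AA -> AE -> AE).
Proof. exact: tmap2_bilinear. Qed.
Let dl : linear (diff : A -> E). Proof. exact: linearP. Qed.
Let Sl : linear (antipode : A -> A). Proof. exact: linearP. Qed.
Let cl : linear (comul : A -> AA). Proof. exact: linearP. Qed.
Let idl : linear (@id A). Proof. by []. Qed.
Let idl2 : linear (@id AA). Proof. by []. Qed.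

(* Woronowicz's [S(a_(1)) d a_(2)]. *)
Definition maurer_cartan : A -> E := conv (@lact _ _ E) antipode diff.

Lemma maurer_cartan_linear : linear maurer_cartan.
Proof. exact: conv_linear. Qed.
Let ml := maurer_cartan_linear.

(** In convolution notation, id * (S * d) = (id * S) * d = counit * d = d. *)
Lemma diff_maurer_cartan a : diff a = conv (@lact _ _ E) id maurer_cartan a.
Proof.
rewrite -(convA (op1 := @lact _ _ E) (op2 := *%R)) //; last exact: lactM.
rewrite -[LHS]conv_counit //; apply: conv_ext => b c.
rewrite [conv _ _ _ b]antipodeR.
by rewrite (linear_scaleE (lactb.2 (diff c))) lact1.
Qed.

Let tens1 (x : E) : AE := 1 \ox x.
Let tens1l : linear tens1.
Proof. exact: (tens_bilinear A E).1. Qed.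

(* As [(id ⊗ d)Delta = Delta * (1 ⊗ maurer_cartan)] in the convolution algebra,
   multiplying by [Delta o S], the left inverse of [Delta], gives the claim
   without the anti-comultiplicativity of the antipode. *)
Lemma lcoact_maurer_cartan a : lcoact E (maurer_cartan a) = 1 \ox maurer_cartan a.
Proof.
have U := linear_compose tens1l ml.
have CS := linear_compose cl Sl.
have lactDE b : tmap id diff (comul b) =
    conv (tmap2 *%R (@lact _ _ E)) comul (tens1 \o maurer_cartan) b.
  have actb1 := bilinear_comp actb idl2 tens1l.
  have -> : tmap id diff (comul b) =
      conv (@tens _ A E) id (conv (@lact _ _ E) id maurer_cartan) b.
    rewrite -[LHS]/(conv (@tens _ A E) id diff b); apply: conv_ext => u v.
    by rewrite diff_maurer_cartan.
  (* The convolution of [id] with itself along [tens] is Delta. *)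
  rewrite -(convA (op1 := fun z x => tmap2 *%R (@lact _ _ E) z (tens1 x))
      (op2 := @tens _ A A)) //; try exact: tens_bilinear.
    apply: conv_ext => u v /=; congr (tmap2 _ _ _ _).
    exact: tlift_id.
  by move=> u v w; rewrite /tens1 (tmap2_tens _ _ _ _ mulb lactb) mulr1.
rewrite [LHS](linear_conv _ (lcoact_linear E_bicov) lactb Sl dl).
have -> : conv (fun u v => lcoact E (lact u v)) antipode diff a =
    conv (tmap2 *%R (@lact _ _ E)) (comul \o antipode)
      (conv (tmap2 *%R (@lact _ _ E)) comul (tens1 \o maurer_cartan)) a.
  by apply: conv_ext => u v; rewrite /= lcoact_lact // lcoact_diff // lactDE.
rewrite -(convA (op1 := tmap2 *%R (@lact _ _ E)) (op2 := tmap2 *%R *%R)) //; last first.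
  move=> u v w; apply: tmap2A => // [b c e|b c e]; first by rewrite mulrA.
  by rewrite lactM.
rewrite -[RHS](conv_counit _ U); apply: conv_ext => b c.
(* Delta is an algebra map, so it carries the antipode identity S * id = counit to this one. *)
have -> : conv (tmap2 *%R *%R) (comul \o antipode) comul b = counit b *: (1 \ox 1 : AA).
  rewrite -comul1 -linearZ -antipodeL [RHS](linear_conv _ cl mulb Sl idl).
  by apply: conv_ext => u v; rewrite /= comulM.
rewrite (linear_scaleE (actb.2 _)).
by rewrite /= /tens1 (tmap2_tens _ _ _ _ mulb lactb) mulr1 lact1.
Qed.

(** Surjectivity of the multiplication map from A ⊗ ₀E to E: in a presentation by terms a db, each
    db is replaced using [diff_maurer_cartan]. *)
Lemma linv_generated (x : E) : exists2 s : seq (A * E),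
  {in s, forall p, p.2 \in linv (lcoact E)} & x = \sum_(p <- s) lact p.1 p.2.
Proof.
pose G x := exists2 s : seq (A * E), {in s, forall p, p.2 \in linv (lcoact E)}
  & x = \sum_(p <- s) lact p.1 p.2.
have GD y z : G y -> G z -> G (y + z).
  move=> [s ss ->] [t tt ->]; exists (s ++ t); last by rewrite big_cat.
  by move=> p; rewrite mem_cat => /orP[/ss|/tt].
have G0 : G 0 by exists [::]; rewrite ?big_nil.
have Gsum (I : Type) (r : seq I) (F : I -> E) :
    (forall i, G (F i)) -> G (\sum_(i <- r) F i) by move=> GF; apply: big_ind.
have [s ->] := diff_span x; apply/Gsum => -[a b] /=.
rewrite diff_maurer_cartan /conv; have [t ->] := tens_sum (comul b).
rewrite (linear_sumE (tlift_linear (bilinear_comp lactb idl ml))).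
rewrite (linear_sumE (lactb.1 a)); apply/Gsum => -[u v] /=.
rewrite tlift_tens; last exact: bilinear_comp.
exists [:: (a * u, maurer_cartan v)]; last by rewrite big_seq1 lactM.
by move=> p; rewrite inE => /eqP -> /=; rewrite inE lcoact_maurer_cartan.
Qed.

End LeftInvariantForms.

(** * From eigenvectors among generators to the whole bimodule *)

Section EigenvectorSpan.
Variables (K : fieldType) (A : algType K) (M : bimodule A) (sigma : bimodHom M M).

Lemma eigensum_lact a x : eigensum sigma x -> eigensum sigma (lact a x).
Proof.
have ll := (lact_bilinear M).1 a.
move=> [s s_eig ->]; rewrite (linear_sumE ll).
exists [seq (p.1, lact a p.2) | p <- s]; last by rewrite big_map.
move=> _ /mapP[p /s_eig p_eig ->] /=.
by rewrite bimod_lact p_eig (linear_scaleE ll).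
Qed.

Lemma eigensum_linear_comb n (c : 'I_n -> K) (b : 'I_n -> M) :
  (forall i, exists l, sigma (b i) = l *: b i) ->
  eigensum sigma (\sum_i c i *: b i).
Proof.
move=> b_eig; apply: eigensum_sum => i _; have [l bl] := b_eig i.
exists [:: (l, c i *: b i)]; last by rewrite big_seq1.
by move=> p; rewrite inE => /eqP -> /=; rewrite linearZ /= bl !scalerA mulrC.
Qed.

(* [M] stands for [N ⊗_A N'] with [t] for the tensor of two vectors; if [I] and
   [I'] generate [N] and [N'] as left modules, [t I I'] generates [M]. *)
Lemma eigensum_balanced (N N' : bimodule A) (t : N -> N' -> M)
    (I : {pred N}) (I' : {pred N'}) :
  bilinear_map t -> (forall x a y, t (ract x a) y = t x (lact a y)) ->
  (forall a x y, lact a (t x y) = t (lact a x) y) ->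
  (forall z, exists s : seq (N * N'), z = \sum_(p <- s) t p.1 p.2) ->
  (forall x, exists2 s : seq (A * N),
     {in s, forall p, p.2 \in I} & x = \sum_(p <- s) lact p.1 p.2) ->
  (forall y, exists2 s : seq (A * N'),
     {in s, forall p, p.2 \in I'} & y = \sum_(p <- s) lact p.1 p.2) ->
  (forall x y, x \in I -> y \in I' -> eigensum sigma (t x y)) ->
  forall z, eigensum sigma z.
Proof.
move=> tb t_bal t_lact t_span I_gen I'_gen II'_eig z.
have [s ->] := t_span z; apply: eigensum_sum => -[x y] _ /=.
have [r rI' ->] := I'_gen y.
rewrite (linear_sumE (tb.1 x)) big_seq; apply: eigensum_sum => -[c w] /rI' /= wI'.
(* The coefficient [c] first crosses to the left factor; only then is that factor expanded, so that
   all remaining coefficients stand on the far left. *)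
rewrite -t_bal; have [q qI ->] := I_gen (ract x c).
rewrite (linear_sumE (tb.2 w)) big_seq; apply: eigensum_sum => -[a v] /qI /= vI.
by rewrite -t_lact; apply/eigensum_lact/II'_eig.
Qed.

End EigenvectorSpan.

Lemma tensA_sum (K : fieldType) (A : algType K) (M N : bimodule A)
    (z : tprodA M N) :
  exists s : seq (M * N), z = \sum_(p <- s) tensA p.1 p.2.
Proof.
have [t ->] := lproj_surj z; have [s ->] := tens_sum t.
by exists s; rewrite raddf_sum.
Qed.

(** The inclusion of ₀E ⊗ ₀E in ₀(E ⊗_A E), which lets the eigenbasis of the latter expand tensors
    of invariant forms. *)
Lemma linv_tensA (K : fieldType) (A : hopfAlgebra K) (E : calculus A) (x y : E) :
  bicovariant E -> x \in linv (lcoact E) -> y \in linv (lcoact E) ->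
  tensA x y \in linv (lcoact2 E).
Proof.
move=> E_bicov; rewrite !inE => /eqP xE /eqP yE; rewrite lcoact2_tensA // xE yE.
rewrite tmap2_tens ?mulr1 //; last exact: tensA_bilinear.
by split=> a k b c; rewrite ?mulrDr ?mulrDl -?scalerAl -?scalerAr.
Qed.

Lemma eigensum_braiding (K : fieldType) (A : hopfAlgebra K) (E : calculus A)
    (sigma : bimodHom (tprodA E E) (tprodA E E)) (z : tprodA E E) :
  bicovariant E -> diagonalisable_on sigma (linv (lcoact2 E)) ->
  eigensum sigma z.
Proof.
move=> E_bicov [n [b [[_ _ b_span] b_eig]]]; move: z.
apply: (eigensum_balanced (t := @tensA _ _ E E)
  (I := linv (lcoact E)) (I' := linv (lcoact E))).
- exact: tensA_bilinear.
- exact: tensA_balanced.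
- exact: lact_tensA.
- exact: tensA_sum.
- exact: linv_generated.
- exact: linv_generated.
move=> x y x_inv y_inv; have [c ->] := b_span _ (linv_tensA E_bicov x_inv y_inv).
exact: eigensum_linear_comb.
Qed.

(** * The image of a bimodule map as a sub-bimodule *)

Section Images.
Variables (K : fieldType) (A : algType K) (M N : bimodule A) (f : bimodHom M N).

Definition image_pred : {pred N} := fun y => `[< exists x, y = f x >].

Lemma image_submod : submod_closed image_pred.
Proof.
split=> [|k _ _ /asboolP[x ->] /asboolP[y ->]]; apply/asboolP.
  by exists 0; rewrite raddf0.
by exists (k *: x + y); rewrite linearP.
Qed.

Lemma image_lact a y : y \in image_pred -> lact a y \in image_pred.
Proof.
by move=> /asboolP[x ->]; apply/asboolP; exists (lact a x); rewrite bimod_lact.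
Qed.

Lemma image_ract y a : y \in image_pred -> ract y a \in image_pred.
Proof.
by move=> /asboolP[x ->]; apply/asboolP; exists (ract x a); rewrite bimod_ract.
Qed.

Definition imageB : subBimod N := SubBimod image_submod image_lact image_ract.

Lemma imageP y : reflect (exists x, y = f x) (y \in imageB).
Proof. exact: asboolP. Qed.

End Images.

(** * Complements and quotients *)

Section Complement.
Variables (K : fieldType) (A : algType K) (M : bimodule A).

Lemma mem_kerB_quot (W : subBimod M) x : (x \in kerB (quot_hom W)) = (x \in W).
Proof. by rewrite inE; apply/eqP/idP => /lproj_eq0. Qed.

(** Injectivity is the trivial intersection with [W]. For surjectivity, the [W]-component of any
    representative dies in the quotient. *)
Lemma quot_hom_iso_complement (W F : subBimod M) :
  direct_sum W F -> right_module_iso_on F (quot_hom W).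
Proof.
move=> [WF_sum WF0]; split=> [k x y _ _|x a _|x y Fx Fy xy|y].
- exact: linearP.
- exact: bimod_ract.
- by apply/subr0_eq/WF0; [apply/lproj_eq|rewrite rpredB].
have [x ->] := lproj_surj y; have [w [u [Ww Fu ->]]] := WF_sum x.
by exists u => //; apply/lproj_eq; rewrite opprD addrCA subrr addr0 rpredN.
Qed.

Lemma direct_sum_ker_image (sigma : bimodHom M M) :
  (forall x, eigensum sigma x) ->
  direct_sum (kerB (sub_hom sigma (id_hom M))) (imageB (sub_hom sigma (id_hom M))).
Proof.
move=> sigma_eig; split=> [x|y].
  have [u [z [ufix ->]]] := eigensum_split (sigma_eig x).
  exists u, (sigma z - z); split=> //; first by rewrite inE /= ufix subrr.
  by apply/imageP; exists z.
rewrite inE /= subr_eq0 => /eqP yfix /imageP[z yE]; rewrite yE in yfix *.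
exact: eigensum_ker_im (sigma_eig z) yfix.
Qed.

(** The wedge map is [quot_hom W] for W = Ker(σ - 1); its kernel is a different term from [W], with
    the same elements. *)
Lemma ex_bimod_complement (W F : subBimod M) : direct_sum W F ->
  exists G : subBimod M,
    direct_sum (kerB (quot_hom W)) G /\ right_module_iso_on G (quot_hom W).
Proof.
move=> WF; exists F; split; last exact: quot_hom_iso_complement.
case: WF => WF_sum WF0; split=> [x|x]; last by rewrite mem_kerB_quot; apply: WF0.
have [u [w [Wu Fw ->]]] := WF_sum x.
by exists u, w; rewrite mem_kerB_quot.
Qed.

End Complement.

Theorem theorem1p1 (R : realType) (A : hopfAlgebra R[i]) (E : calculus A)
    (E_bicov : bicovariant E)
    (E_linv : finite_dimensional (linv (lcoact E)))
    (E_rinv : finite_dimensional (rinv (rcoact E)))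
    (sigma : bimodHom (tprodA E E) (tprodA E E))
    (sigmaP : is_braiding sigma)
    (sigma0_diag : diagonalisable_on sigma (linv (lcoact2 E))) :
  exists F : subBimod (tprodA E E),
    direct_sum (kerB (wedge sigma)) F /\
    right_module_iso_on F (wedge sigma).
Proof.
(* The placeholder is resolved to σ - 1, so the complement is Im(σ - 1). *)
apply: ex_bimod_complement (imageB _) (direct_sum_ker_image _) => z.
exact: eigensum_braiding.
Qed.
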